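(* Let $a,b,c\ge 0$ be integers, $n=a+b+c$, and let $s_A<s_B<s_C$ be positive reals with $s_A/s_B<1/2$ and $s_B/s_C<1/2$. Let $\mathcal{X}_3(n)$ be the three-type linear particle system on $\Omega_{a,b,c}$ with strengths $s_A,s_B,s_C$. Then the mixing time satisfies $t(\mathcal{X}_3(n))=O(n^{10})$.
   Context: $\Omega_{a,b,c}$ is the set of all linear arrangements (words of length $n$) of $a$ indistinguishable particles of type $A$, $b$ of type $B$ and $c$ of type $C$; positions are $1,\dots,n$. The linear particle system $\mathcal{X}_3(n)$ is the Markov chain on $\Omega_{a,b,c}$ which, from state $\sigma$, chooses $i\in\{1,\dots,n-1\}$ uniformly at random; if $\sigma(i)$ and $\sigma(i+1)$ have the same type it does nothing; otherwise, if the two particles have types $t\ne t'$, it places the particle of type $t$ at position $i+1$ and the one of type $t'$ at position $i$ with probability $s_t/(s_t+s_{t'})$, and the other way round with probability $s_{t'}/(s_t+s_{t'})$. Its stationary distribution is $\pi(\sigma)\propto\prod_{i=1}^n s_{\sigma(i)}^{\,i}$. For a Markov chain $\mathcal{M}$ with stationary distribution $\pi$, the mixing time $t(\mathcal{M})$ is the least $t$ such that $\max_x\|P^t(x,\cdot)-\pi\|_{TV}\le 1/4$. *)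

(* Defs.v *)
From HB Require Import structures.
From mathcomp Require Import all_boot all_order all_algebra.
From mathcomp Require Import reals.

Set Implicit Arguments.
Unset Strict Implicit.
Unset Printing Implicit Defensive.

Import Order.TTheory GRing.Theory Num.Theory.

Local Open Scope ring_scope.

Section MarkovChains.
Variables (R : realType) (T : finType).
Implicit Types (P : T -> T -> R) (mu nu pi : T -> R) (t : nat).

Fixpoint kernel_pow P t (x y : T) : R :=
  if t is t'.+1 then \sum_z P x z * kernel_pow P t' z y else (x == y)%:R.

Definition tv_dist mu nu : R := 2^-1 * \sum_x `|mu x - nu x|.

(* The bigop default 0 is harmless: the distances are nonnegative. *)
Definition worst_tv P pi t : R :=
  \big[Num.max/0]_x tv_dist (kernel_pow P t x) pi.

(* A relation rather than a function, so that asserting that some t is the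
   mixing time includes the claim that the mixing time is finite. *)
Definition is_mixing_time P pi t : Prop :=
  worst_tv P pi t <= 1 / 4 /\
  forall t', worst_tv P pi t' <= 1 / 4 -> (t <= t')%N.

End MarkovChains.

Inductive particle : predArgType := A | B | C.

Definition ord_of_particle (p : particle) : 'I_3 :=
  match p with A => inord 0 | B => inord 1 | C => inord 2 end.

Definition particle_of_ord (k : 'I_3) : particle :=
  match val k with 0%N => A | 1%N => B | _ => C end.

Lemma ord_of_particleK : cancel ord_of_particle particle_of_ord.
Proof. by case; rewrite /particle_of_ord /= inordK. Qed.

HB.instance Definition _ := Finite.copy particle (can_type ord_of_particleK).

Definition word (n : nat) := {ffun 'I_n -> particle}.

Definition has_content (a b c n : nat) (w : word n) : bool :=
  [&& #|[set i | w i == A]| == a,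
      #|[set i | w i == B]| == b &
      #|[set i | w i == C]| == c].

Definition Omega (a b c : nat) : Type :=
  {w : word (a + b + c) | has_content a b c w}.

HB.instance Definition _ (a b c : nat) := Finite.on (Omega a b c).

Section ParticleSystem.
Variables (R : realType) (s : particle -> R).

Definition place n (w : word n) (i j : 'I_n) (p q : particle) : word n :=
  [ffun k => if k == i then p else if k == j then q else w k].

(* Probability that w becomes w' when the adjacent positions i and j = i + 1
   have been chosen. *)
Definition local_step n (i j : 'I_n) (w w' : word n) : R :=
  if w i == w j then (w' == w)%:R
  else s (w i) / (s (w i) + s (w j)) * (w' == place w i j (w j) (w i))%:R
     + s (w j) / (s (w i) + s (w j)) * (w' == place w i j (w i) (w j))%:R.

(* Ordinals are 0-based.  When n <= 1 there is no adjacent pair to choose and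
   the state space is a singleton; the chain is then taken to stand still. *)
Definition X3 (a b c : nat) (x y : Omega a b c) : R :=
  let n := (a + b + c)%N in
  if (n <= 1)%N then (x == y)%:R
  else (n.-1)%:R^-1 *
       \sum_(i < n) \sum_(j < n | j == i.+1 :> nat)
          local_step i j (val x) (val y).

(* Position i : 'I_n is the 1-based position i.+1, whence the exponent. *)
Definition weight n (w : word n) : R := \prod_(i < n) s (w i) ^+ i.+1.

Definition stationary (a b c : nat) (x : Omega a b c) : R :=
  weight (val x) / \sum_(y : Omega a b c) weight (val y).

End ParticleSystem.

(* Main.v *)
Require Import Defs.
From HB Require Import structures.
From mathcomp Require Import all_boot all_order all_algebra.
From mathcomp Require Import reals.
From mathcomp Require Import perm zify ring lra.

(** Join every word to the sorted word A..AB..BC..C by repeatedly exchanging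
    the leftmost adjacent pair (non-A, A), or, once all the A's are in front,
    the leftmost adjacent pair CB.  In the resulting tree a word has at most two
    children of each kind, and each child has less than half the stationary
    weight of its parent because s_A/s_B and s_B/s_C are below 1/2.  Hence the
    image of the stationary measure pi under any iterate of the sorting step is
    at most a constant times pi off the sorted word.  Telescoping along the
    paths of length at most 2 n^2 gives a Poincare inequality with constant
    O(n^4) for the unnormalized sum over all adjacent exchanges.

    The chain is the average of n - 1 heat-bath updates.  Each of them is an
    orthogonal projection in L^2(pi), so by convexity one step of the chain
    lowers the square norm of a mean-zero function by a factor 1 - c n^-5,
    without any discussion of negative eigenvalues.  Applied to the functions
    x |-> P^t(x, y) - pi(y), together with log (1 / min pi) = O(n^2) and
    log #|Omega| = O(n), this yields a mixing time O(n^7). *)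

Set Implicit Arguments.
Unset Strict Implicit.
Unset Printing Implicit Defensive.

Import Order.TTheory GRing.Theory Num.Theory.

Local Open Scope ring_scope.

(** * Two elementary inequalities *)

Lemma sqr_sum_le (R : realFieldType) (I : finType) (P : pred I) (F : I -> R) :
  (\sum_(i | P i) F i) ^+ 2 <= #|P|%:R * \sum_(i | P i) F i ^+ 2.
Proof.
case: (posnP #|P|) => [P0|Ppos].
  rewrite P0 mul0r big_pred0 ?expr0n // => i.
  by have := card0_eq P0 i; rewrite inE unfold_in => ->.
set S := \sum_(i | P i) F i; set N : R := #|P|%:R.
have N0 : 0 < N by rewrite ltr0n.
(* Expanding this sum of squares gives [N] times the difference of the two sides. *)
have : 0 <= \sum_(i | P i) (N * F i - S) ^+ 2.
  by apply: sumr_ge0 => i _; apply: sqr_ge0.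
have -> : \sum_(i | P i) (N * F i - S) ^+ 2 =
          N * (N * (\sum_(i | P i) F i ^+ 2) - S ^+ 2).
  under eq_bigr => i _.
    rewrite (_ : _ ^+ 2 = N ^+ 2 * F i ^+ 2 - 2 * N * S * F i + S ^+ 2);
      last by ring.
    over.
  rewrite big_split sumrB /=.
  have -> : \sum_(i | P i) S ^+ 2 = N * S ^+ 2 by rewrite mulr_natl -sumr_const.
  by rewrite -!mulr_sumr -/S; ring.
by rewrite pmulr_rge0 // subr_ge0.
Qed.

(** For [M > 1], [1 - 1/M] is the inverse of [1 + 1/(M-1)], whose [M]-th power is at least
    [1 + M/(M-1) >= 2] by Bernoulli. This turns a gap [1/M] into a halving every [M] steps. *)
Lemma expr_1subV_le_half (R : realFieldType) (M : nat) :
  (0 < M)%N -> (1 - M%:R^-1 : R) ^+ M <= 2^-1.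
Proof.
case: M => // m _.
case: m => [|m]; first by rewrite invr1 subrr expr0n /= invr_ge0.
have m0 : (0 : R) < m.+1%:R by rewrite ltr0n.
have -> : (1 - m.+2%:R^-1 : R) = (1 + m.+1%:R^-1)^-1.
  by rewrite -[m.+2%:R]natr1; field; lra.
rewrite exprVn lef_pV2 ?posrE ?exprn_gt0 //; last first.
  by rewrite addr_gt0 ?invr_gt0.
have ber k : 1 + k%:R * m.+1%:R^-1 <= (1 + m.+1%:R^-1 : R) ^+ k.
  elim: k => [|k IH]; first by rewrite mul0r addr0 expr0.
  rewrite exprS; have i0 : (0 : R) < m.+1%:R^-1 by rewrite invr_gt0.
  have k0 : (0 : R) <= k%:R by rewrite ler0n.
  rewrite -natr1; set u := m.+1%:R^-1 in i0 IH *.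
  apply: le_trans (_ : (1 + u) * (1 + k%:R * u) <= _).
    rewrite -subr_ge0.
    rewrite [X in 0 <= X](_ : _ = k%:R * (u * u)); last by ring.
    by rewrite mulr_ge0 // mulr_ge0 // ltW.
  by rewrite ler_pM2l ?addr_gt0.
apply: le_trans (ber m.+2).
have : (m.+2%:R : R) * m.+1%:R^-1 >= 1.
  by rewrite -ler_pdivrMr ?invr_gt0 // invrK mul1r ler_nat.
by move: (_ * _) => z; lra.
Qed.

(** * Words, adjacent exchanges and descents *)

Section Words.
Variable n : nat.
Implicit Types (w x y : word n) (h : particle -> bool) (k : nat).

Definition swap (i j : 'I_n) w : word n := [ffun k => w (tperm i j k)].

Lemma swapK i j : involutive (swap i j).
Proof. by move=> w; apply/ffunP=> k; rewrite !ffunE tpermK. Qed.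

Lemma swap_content a b c i j w :
  has_content a b c (swap i j w) = has_content a b c w.
Proof.
have E p : #|[set k | swap i j w k == p]| = #|[set k | w k == p]|.
  rewrite -(card_preimset [set k | w k == p] (@perm_inj _ (tperm i j))).
  by apply: eq_card => k; rewrite !inE ffunE.
by rewrite /has_content !E.
Qed.

(* Beyond the word the letter is C: a trailing C never closes a descent of
   either predicate [nonA] or [isC] used below. *)
Definition letter w k : particle := if insub k is Some i then w i else C.

Lemma letter_ord w (i : 'I_n) : letter w i = w i.
Proof. by rewrite /letter valK. Qed.

Lemma letter_out w k : (n <= k)%N -> letter w k = C.
Proof. by move=> nk; rewrite /letter insubF // ltnNge nk. Qed.

Lemma letter_swap (i j : 'I_n) w k : j = i.+1 :> nat ->
  letter (swap i j w) k = if k == i then letter w i.+1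
                          else if k == i.+1 then letter w i else letter w k.
Proof.
move=> ij; case: (ltnP k n) => kn; last first.
  have jn : (i.+1 < n)%N by rewrite -ij.
  by rewrite !gtn_eqF ?letter_out ?(leq_trans jn) // ltnW ?(leq_trans jn).
rewrite -[k]/(val (Ordinal kn)) !letter_ord ffunE.
case: tpermP => [->|->|/eqP ni /eqP nj] /=.
- by rewrite eqxx -ij letter_ord.
- by rewrite ij eqxx gtn_eqF // letter_ord.
- move: ni nj; rewrite -!val_eqE /= -ij => /negbTE -> /negbTE ->.
  by rewrite -letter_ord.
Qed.

(** For [nonA] these are the pairs (non-A, A); for [isC] the pairs (C, non-C), which are all CB once
    no [nonA] descent is left. *)
Definition descent h w k := h (letter w k) && ~~ h (letter w k.+1).

Definition has_descent h w := has (descent h w) (iota 0 n).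

Definition first_descent h w := find (descent h w) (iota 0 n).

Definition swap_at k w : word n :=
  if (insub k, insub k.+1) is (Some i, Some j) then swap i j w else w.

Lemma swap_atE (i j : 'I_n) w : j = i.+1 :> nat -> swap_at i w = swap i j w.
Proof. by move=> ij; rewrite /swap_at -ij !valK. Qed.

Lemma swap_at_content a b c k w :
  has_content a b c (swap_at k w) = has_content a b c w.
Proof. by rewrite /swap_at; do 2! case: insub => //= ?; rewrite swap_content. Qed.

Lemma swap_atK k : involutive (swap_at k).
Proof. by move=> w; rewrite /swap_at; do 2! case: insub => //= ?; rewrite swapK. Qed.

Lemma find_iota (p : pred nat) k : (k < n)%N -> p k ->
  (forall j, (j < k)%N -> ~~ p j) -> find p (iota 0 n) = k.
Proof.
move=> kn pk nj; case: findP => [/hasPn/(_ k)|i].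
  by rewrite mem_iota kn /= pk => /(_ isT).
rewrite size_iota => iN /(_ 0%N); rewrite nth_iota // add0n => pi lt.
case: (ltngtP i k) => // [/nj|ki]; first by rewrite pi.
by have := lt 0%N k ki; rewrite nth_iota // add0n pk.
Qed.

Lemma first_descentP h w : h C -> has_descent h w ->
  [/\ ((first_descent h w).+1 < n)%N, descent h w (first_descent h w)
    & forall j, (j < first_descent h w)%N -> ~~ descent h w j].
Proof.
move=> hC hd; have := hd.
rewrite {1}/has_descent has_find size_iota -/(first_descent h w) => lt.
have dk : descent h w (first_descent h w).
  by have := nth_find 0%N hd; rewrite nth_iota.
split=> //.
- rewrite ltnNge; apply/negP => le; case/andP: dk => _.
  by rewrite letter_out // hC.
- move=> j jk; have := before_find 0%N jk; rewrite nth_iota ?add0n ?(ltn_trans jk) //.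
  by move->.
Qed.

Lemma has_descentP h w k : h C -> descent h w k -> has_descent h w.
Proof.
move=> hC dk; apply/hasP; exists k => //; rewrite mem_iota /= add0n.
rewrite ltnNge; apply/negP => le; case/andP: dk => _.
by rewrite letter_out ?hC // leqW.
Qed.

(** One less than the position of the first [h]-letter past position 0: the place of the last
    exchange if that exchange moved the first [h]-letter to the right. *)
Definition first_rise h w := find (fun k => h (letter w k.+1)) (iota 0 n).

Lemma letter_swap_at k w m : (k.+1 < n)%N ->
  letter (swap_at k w) m = if m == k then letter w k.+1
                          else if m == k.+1 then letter w k else letter w m.
Proof.
move=> k1; have k0 := ltnW k1.
rewrite (@swap_atE (Ordinal k0) (Ordinal k1)) //.
exact: (@letter_swap (Ordinal k0) (Ordinal k1)).
Qed.

Lemma mono_no_descent h w i j : (forall k, (i <= k < j)%N -> ~~ descent h w k) ->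
  (i <= j)%N -> h (letter w i) -> h (letter w j).
Proof.
move=> nd ij hi; elim: j ij nd => [|j IH]; first by rewrite leqn0 => /eqP <-.
rewrite leq_eqVlt => /orP[/eqP <- //|]; rewrite ltnS => ij nd.
have hj : h (letter w j) by apply: IH => // k /andP[ik kj]; apply: nd; lia.
by have := nd j; rewrite ij ltnSn /descent hj negbK => ->.
Qed.

(* Undoing a sorting step at [k]: either the letters up to [k] do not satisfy
   [h], or the run of [h]-letters before [k] now ends in the first descent. *)
Lemma swap_first_descent h y (k := first_descent h y) (x := swap_at k y) :
  h C -> has_descent h y ->
  k = first_rise h x \/ (has_descent h x /\ k = (first_descent h x).+1).
Proof.
move=> hC hd; have [k1 /andP[hk hk1] bk] := first_descentP hC hd.
rewrite -/k in k1 hk hk1 bk.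
have lx m : letter x m = _ := letter_swap_at y m k1.
have bx m : (m < k)%N -> letter x m = letter y m.
  by move=> mk; rewrite lx !ltn_eqF // ltnW.
(* No descent of [y] precedes [k], so an [h]-letter before [k] propagates up to [k.-1]; the exchange
   puts a non-[h] letter right after it. *)
have [hx|nx] := boolP (has (fun j => h (letter y j)) (iota 0 k)).
  right; case/hasP: hx => j; rewrite mem_iota /= add0n => jk hj.
  have Ek : k = k.-1.+1 by lia.
  have dx : descent h x k.-1.
    rewrite /descent -Ek (lx k) eqxx hk1 andbT bx; last by lia.
    by apply: mono_no_descent hj => [m mk|]; [apply: bk|]; lia.
  split; first exact: has_descentP dx.
  rewrite {1}Ek; congr _.+1; symmetry; apply: find_iota => //; first by lia.
  by move=> m mk; rewrite /descent !bx; [apply: bk| |]; lia.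
(* Here the first [h]-letter of [y] is at [k], hence that of [x] is at [k.+1]. *)
left; symmetry; apply: find_iota; first by lia.
  by rewrite lx eqxx gtn_eqF.
move=> j jk; have [->|nj] := eqVneq j.+1 k; first by rewrite lx eqxx.
rewrite bx; last by lia.
by have /hasPn/(_ j.+1) := nx; rewrite mem_iota; apply; lia.
Qed.

End Words.

(** * The sorting step, its termination and its unique end point *)

Definition nonA (p : particle) := if p is A then false else true.

Definition isC (p : particle) := if p is C then true else false.

Definition level (p : particle) : nat :=
  match p with A => 0 | B => 1 | C => 2 end.

Section Sorting.
Variable n : nat.
Implicit Types (w x y : word n) (h : particle -> bool) (k : nat).

Definition sort_step w : word n :=
  if has_descent nonA w then swap_at (first_descent nonA w) w
  else if has_descent isC w then swap_at (first_descent isC w) w else w.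

Definition sorted_word w := ~~ has_descent nonA w && ~~ has_descent isC w.

Lemma sort_step_swap w : sort_step w = w \/
  exists i j : 'I_n, j = i.+1 :> nat /\ sort_step w = swap i j w.
Proof.
have aux k : swap_at k w = w \/
    exists i j : 'I_n, j = i.+1 :> nat /\ swap_at k w = swap i j w.
  rewrite /swap_at; case: insubP => [i _ <-|]; last by left.
  by case: insubP => [j _ ij|]; [right; exists i, j|left].
by rewrite /sort_step; do 2! [case: ifP => _; first exact: aux]; left.
Qed.

Lemma sort_step_content a b c w :
  has_content a b c (sort_step w) = has_content a b c w.
Proof. by rewrite /sort_step; do ![case: ifP => _]; rewrite ?swap_at_content. Qed.

(** A potential for termination: moving the higher of two neighbours one place to the right lowers
    it by the difference of their levels. *)
Definition rank w := (\sum_(i < n) (n - i) * level (w i))%N.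

Lemma rank_le w : (rank w <= 2 * n ^ 2)%N.
Proof.
apply: (@leq_trans (\sum_(i < n) 2 * n)%N); last first.
  by rewrite sum_nat_const card_ord; lia.
apply: leq_sum => i _; rewrite mulnC leq_mul ?leq_subr //.
by case: (w i).
Qed.

Lemma rank_swap_at k w : (k.+1 < n)%N ->
  (level (letter w k.+1) < level (letter w k))%N ->
  (rank (swap_at k w) < rank w)%N.
Proof.
move=> k1; have k0 := ltnW k1.
set i := Ordinal k0; set j := Ordinal k1.
rewrite (@swap_atE _ i j) // -[k.+1]/(val j) -[k]/(val i) !letter_ord => lt.
have ji : j != i by rewrite -val_eqE /= gtn_eqF.
rewrite /rank (bigD1 i) // (bigD1 j) //= [X in (_ < X)%N](bigD1 i) //.
rewrite [X in (_ < X)%N](_ : _ = (n - i) * level (w i) + (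
  (n - j) * level (w j) + \sum_(l < n | (l != i) && (l != j))
  (n - l) * level (w l)))%N; last by rewrite (bigD1 j).
rewrite !ffunE tpermL tpermR.
under eq_bigr => l /andP[li lj] do rewrite ffunE tpermD 1?eq_sym //.
have -> : (n - i = (n - j).+1)%N by rewrite subnSK.
by rewrite !mulSn -[k.+1]/(val j); move: (_ * _)%N (_ * _)%N (bigop _ _ _) lt => *; lia.
Qed.

Lemma sort_step_rank w : ~~ sorted_word w -> (rank (sort_step w) < rank w)%N.
Proof.
rewrite /sorted_word negb_and !negbK /sort_step.
case: ifP => [hd _|_ /= hd].
  have [//|k1 /andP[hk hk1] _] := first_descentP _ hd.
  apply: rank_swap_at => //; move: hk hk1.
  by case: (letter w _) => //; case: (letter w _).
rewrite hd; have [//|k1 /andP[hk hk1] _] := first_descentP _ hd.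
apply: rank_swap_at => //; move: hk hk1.
by case: (letter w _) => //; case: (letter w _).
Qed.

Lemma sort_step_sorted w : sorted_word w -> sort_step w = w.
Proof. by case/andP => /negbTE nA /negbTE nC; rewrite /sort_step nA nC. Qed.

Lemma iter_sort_step_sorted k w : (rank w <= k)%N -> sorted_word (iter k sort_step w).
Proof.
elim: k w => [|k IH] w /=; first by case: (boolP (sorted_word w)) => // /sort_step_rank; lia.
rewrite -iterS iterSr => le.
have [sw|/sort_step_rank lt] := boolP (sorted_word w); last by apply: IH; lia.
rewrite sort_step_sorted //; elim: k {IH le} => //= k IH.
by rewrite sort_step_sorted.
Qed.

(** Without descents the non-[h] letters fill an initial segment, which is determined by its
    length. *)
Lemma no_descent_card_eq h x y : h C ->
  ~~ has_descent h x -> ~~ has_descent h y ->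
  #|[set i | ~~ h (x i)]| = #|[set i | ~~ h (y i)]| -> forall i, h (x i) = h (y i).
Proof.
move=> hC.
have mono w : ~~ has_descent h w -> forall i j : 'I_n, (i <= j)%N -> h (w i) -> h (w j).
  move=> nd i j ij; rewrite -!letter_ord; apply: mono_no_descent => // k _.
  by apply: contra nd; apply: has_descentP.
suff half x' y' : ~~ has_descent h x' -> ~~ has_descent h y' ->
    #|[set i | ~~ h (x' i)]| = #|[set i | ~~ h (y' i)]| ->
    forall i, h (x' i) -> h (y' i).
  move=> nx ny E i; apply/idP/idP; [exact: half|].
  exact: half (esym E) i.
move=> nx ny E i hx; apply/negP => /negP hy.
suff : [set i | ~~ h (x' i)] \proper [set i | ~~ h (y' i)].
  by move/proper_card; rewrite E ltnn.
apply/properP; split; last by exists i; rewrite inE ?hx.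
apply/subsetP => j; rewrite !inE => hxj.
have ji : (j <= i)%N.
  by rewrite leqNgt; apply/negP => /ltnW /(mono _ nx)/(_ hx); rewrite (negbTE hxj).
by apply: contra hy; apply: mono.
Qed.

Lemma sorted_unique a b c x y : has_content a b c x -> has_content a b c y ->
  sorted_word x -> sorted_word y -> x = y.
Proof.
case/and3P => /eqP xA _ /eqP xC /and3P[/eqP yA _ /eqP yC].
case/andP => nxA nxC /andP[nyA nyC].
have eA w : [set i | ~~ nonA (w i)] = [set i : 'I_n | w i == A].
  by apply/setP => i; rewrite !inE; apply/idP/eqP; case: (w i).
have eC w : [set i | ~~ isC (w i)] = ~: [set i : 'I_n | w i == C].
  by apply/setP => i; rewrite !inE; congr (~~ _); apply/idP/eqP; case: (w i).
have EA : forall i, nonA (x i) = nonA (y i).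
  by apply: no_descent_card_eq => //; rewrite !eA xA yA.
have EC : forall i, isC (x i) = isC (y i).
  have cC (S : {set 'I_n}) : #|~: S| = (n - #|S|)%N.
    by rewrite cardsCs setCK card_ord.
  by apply: no_descent_card_eq => //; rewrite !eC !cC xC yC.
apply/ffunP => i; move: (EA i) (EC i).
by case: (x i); case: (y i).
Qed.

(** The exchanged pair is CB, so the pattern of A's does not move; a pair CA would be a [nonA]
    descent. *)
Lemma sort_step_no_nonA y : ~~ has_descent nonA y -> ~~ has_descent nonA (sort_step y).
Proof.
move=> nA; rewrite /sort_step (negbTE nA); case: ifP => // hd.
have [//|k1 /andP[hk hk1] _] := first_descentP _ hd.
apply: contra (nA) => /hasP[m _ dm].
set k := first_descent isC y in k1 hk hk1 dm.
have nk1 : nonA (letter y k.+1).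
  apply: contraT => /negP n1; case/negP: (nA); apply: (@has_descentP _ _ _ k) => //.
  by rewrite /descent; case: (letter y k) hk => // _; apply/negP.
have E l : nonA (letter (swap_at k y) l) = nonA (letter y l).
  rewrite letter_swap_at //; case: eqP => [->|_]; last case: eqP => [->|//].
  - by rewrite nk1; case: (letter y k) hk.
  - by rewrite nk1; case: (letter y k) hk.
by have := dm; rewrite /descent !E => /(@has_descentP _ nonA y m isT).
Qed.

End Sorting.

(** * Stationary weights along the sorting tree *)

Section Weights.
Variables (R : realType) (s : particle -> R).
Hypotheses (sA_gt0 : 0 < s A) (sAB : s A < s B) (sBC : s B < s C).

Lemma s_gt0 p : 0 < s p.
Proof. by move: sA_gt0 sAB sBC; case: p; lra. Qed.

Variable n : nat.
Implicit Types (w x y : word n) (k : nat).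

Lemma weight_gt0 w : 0 < weight s w.
Proof. by apply: prodr_gt0 => i _; rewrite exprn_gt0 // s_gt0. Qed.

(** The exponents at [i] and [j] differ by one, so the exchange multiplies the weight by
    [s (w i) / s (w j)]. *)
Lemma weight_swap (i j : 'I_n) w : j = i.+1 :> nat ->
  weight s (swap i j w) * s (w j) = weight s w * s (w i).
Proof.
move=> ij; have ji : j != i by rewrite -val_eqE /= ij gtn_eqF.
rewrite /weight (bigD1 i) // (bigD1 j) //= [in RHS](bigD1 i) // [in RHS](bigD1 j) //=.
rewrite !ffunE tpermL tpermR.
under eq_bigr => l /andP[li lj] do rewrite ffunE tpermD 1?eq_sym //.
by rewrite ij !exprS; ring.
Qed.

Lemma weight_swap_at k w : (k.+1 < n)%N ->
  weight s (swap_at k w) * s (letter w k.+1) = weight s w * s (letter w k).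
Proof.
move=> k1; have k0 := ltnW k1.
rewrite (@swap_atE _ (Ordinal k0) (Ordinal k1)) //.
have := letter_ord w (Ordinal k0); have := letter_ord w (Ordinal k1) => /= -> ->.
exact: weight_swap.
Qed.

Hypotheses (ratioAB : s A / s B < 1 / 2) (ratioBC : s B / s C < 1 / 2).

Let rho := s B / s C.

Lemma weight_child k w r : (k.+1 < n)%N ->
  s (letter w k.+1) <= r * s (letter w k) ->
  weight s w <= r * weight s (swap_at k w).
Proof.
move=> k1 le; rewrite -(ler_pM2r (s_gt0 (letter w k))) -weight_swap_at //.
by rewrite mulrAC mulrC ler_pM2r // weight_gt0.
Qed.

Lemma weight_child_nonA y : has_descent nonA y ->
  weight s y <= 2^-1 * weight s (sort_step y).
Proof.
move=> hd; have [//|k1 /andP[hk hk1] _] := first_descentP _ hd.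
rewrite /sort_step hd; apply: weight_child => //.
move: ratioAB; rewrite ltr_pdivrMr ?s_gt0 // => AB.
case: (letter y _) hk => // _; case: (letter y _) hk1 => // _;
  by move: sA_gt0 sAB sBC AB; lra.
Qed.

(** The bound keeps [rho] instead of 1/2, because the gap [1 - 2 * rho] is what makes [phase_weight]
    finite. *)
Lemma weight_child_isC y : ~~ has_descent nonA y -> has_descent isC y ->
  weight s y <= rho * weight s (sort_step y).
Proof.
move=> /negbTE nA hd; have [//|k1 /andP[hk hk1] _] := first_descentP _ hd.
rewrite /sort_step nA hd; apply: weight_child => //; rewrite /rho.
case: (letter y _) hk => // _; rewrite divfK ?gt_eqF ?s_gt0 //.
by case: (letter y _) hk1 => // _; rewrite ltW.
Qed.

(* A word without (non-A, A) descents has, besides its two children of ratio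
   [rho], possibly one more of ratio < 1/2; the larger weight
   [Phi = 1 / (1 - 2 rho)] absorbs it, as [2 rho Phi + 1/2 <= Phi]. *)
Definition phase_weight w : R := if has_descent nonA w then 1 else (1 - 2 * rho)^-1.

Lemma rho_gt0 : 0 < rho. Proof. by rewrite divr_gt0 ?s_gt0. Qed.

Lemma phase_weight_ge1 w : 1 <= phase_weight w.
Proof.
have := rho_gt0; have := ratioBC; rewrite -/rho => r2 r0.
rewrite /phase_weight; case: ifP => // _.
by rewrite invf_ge1; lra.
Qed.

Lemma phase_weight_le w : phase_weight w <= (1 - 2 * rho)^-1.
Proof.
rewrite /phase_weight; case: ifP => // _.
have := rho_gt0; have := ratioBC; rewrite -/rho => r2 r0.
by rewrite invf_ge1; lra.
Qed.

(** The induction step for preimages under iterated sorting; [P] will fix the content. If [x] has a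
    [nonA] descent, its children contribute at most 1/2 + 1/2; otherwise at most
    [1/2 + 2 * rho * Phi], where [Phi - 2 * rho * Phi = 1]. *)
Lemma sum_children x (P : pred (word n)) :
  \sum_(y | P y && (sort_step y == x) && (y != x)) phase_weight y * weight s y
    <= phase_weight x * weight s x.
Proof.
set Phi := (1 - 2 * rho)^-1.
have := rho_gt0; have := ratioBC; rewrite -/rho => r2 r0.
have Phi0 : 0 < Phi by rewrite invr_gt0; lra.
have PhiE : Phi * (1 - 2 * rho) = 1 by rewrite mulVf //; lra.
have Wx := weight_gt0 x.
pose H w : R := (has_descent nonA w)%:R.
pose e y z : R := (y == z :> word n)%:R.
(* By [swap_first_descent] every child is among these four words: [z1], [z2] for a [nonA] exchange,
   [z3], [z4] for an [isC] exchange. *)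
pose z1 := swap_at (first_rise nonA x) x.
pose z2 := swap_at (first_descent nonA x).+1 x.
pose z3 := swap_at (first_rise isC x) x.
pose z4 := swap_at (first_descent isC x).+1 x.
(* [H x] switches off impossible cases: [z2] requires a [nonA] descent in [x], while [z3] and [z4]
   require that there is none. *)
pose G y := weight s x * (e y z1 / 2 + e y z2 * (H x / 2)
              + (e y z3 + e y z4) * (Phi * rho * (1 - H x))).
have e0 y z : 0 <= e y z by rewrite ler0n.
have H0 w : 0 <= H w by rewrite ler0n.
have H1 w : 0 <= 1 - H w by rewrite /H; case: (has_descent _ _); rewrite ?subrr ?subr0.
have PR : 0 <= Phi * rho by rewrite mulr_ge0 // ltW.
have G0 y : 0 <= G y.
  apply: mulr_ge0; first exact: ltW.
  apply: addr_ge0; first apply: addr_ge0.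
  - exact: divr_ge0.
  - by apply: mulr_ge0 => //; apply: divr_ge0.
  - by apply: mulr_ge0; [exact: addr_ge0|exact: mulr_ge0].
have le y : sort_step y = x -> y != x -> phase_weight y * weight s y <= G y.
  move=> yx nyx; rewrite /phase_weight -/Phi; case: ifP => hA.
    have := weight_child_nonA hA; rewrite yx mul1r [2^-1 * _]mulrC => /le_trans; apply.
    have := @swap_first_descent _ nonA y isT hA.
    have -> : swap_at (first_descent nonA y) y = x by rewrite -yx /sort_step hA.
    have yE : y = swap_at (first_descent nonA y) x.
      by rewrite -yx /sort_step hA swap_atK.
    have t3 : 0 <= (e y z3 + e y z4) * (Phi * rho * (1 - H x)).
      by apply: mulr_ge0; [exact: addr_ge0|exact: mulr_ge0].
    rewrite /G ler_pM2l // => -[kE|[hx kE]].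
      have -> : e y z1 = 1 by rewrite /e {1}yE kE eqxx.
      have : 0 <= e y z2 * (H x / 2) by apply: mulr_ge0 => //; apply: divr_ge0.
      lra.
    have -> : e y z2 = 1 by rewrite /e {1}yE kE eqxx.
    have -> : H x = 1 by rewrite /H hx.
    have := e0 y z1; move: t3; rewrite /H hx; lra.
  have hC : has_descent isC y.
    by apply: contraNT nyx => nC; rewrite -yx sort_step_sorted // /sorted_word hA.
  have := weight_child_isC (negbT hA) hC; rewrite yx.
  have nx : has_descent nonA x = false.
    by apply/negbTE; rewrite -yx; apply: sort_step_no_nonA; rewrite hA.
  rewrite -(ler_pM2l Phi0) => /le_trans; apply.
  have := @swap_first_descent _ isC y isT hC.
  have -> : swap_at (first_descent isC y) y = x by rewrite -yx /sort_step hA hC.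
  have yE : y = swap_at (first_descent isC y) x.
    by rewrite -yx /sort_step hA hC swap_atK.
  rewrite mulrA [_ * weight s x]mulrC /G ler_pM2l // /H nx subr0 mulr1 mul0r mulr0 addr0.
  have := e0 y z1; have := e0 y z3; have := e0 y z4.
  move=> h4 h3 h1 [kE|[hx kE]].
    have -> : e y z3 = 1 by rewrite /e {1}yE kE eqxx.
    nra.
  have -> : e y z4 = 1 by rewrite /e {1}yE kE eqxx.
  nra.
have : \sum_(y | P y && (sort_step y == x) && (y != x)) phase_weight y * weight s y
         <= \sum_y G y.
  rewrite [leRHS](bigID (fun y => P y && (sort_step y == x) && (y != x))) /=.
  rewrite ler_wpDr ?sumr_ge0 //; apply: ler_sum => y /andP[/andP[_ /eqP yx] nyx].
  exact: le.
move/le_trans; apply.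
have se z : \sum_y e y z = 1.
  by rewrite /e (bigD1 z) //= eqxx big1 ?addr0 // => y /negbTE ->.
rewrite /G -mulr_sumr !big_split /= -!mulr_suml big_split /= !se mulrC ler_pM2r //.
rewrite /phase_weight -/Phi /H; case: ifP => _ /=; first by rewrite subrr !mulr0; lra.
by rewrite mul0r subr0; lra.
Qed.

End Weights.

(** * Heat-bath updates and the contraction of one step of the chain *)

Section Chain.
Variables (R : realType) (s : particle -> R).
Hypotheses (sA_gt0 : 0 < s A) (sAB : s A < s B) (sBC : s B < s C).
Variables a b c : nat.
Notation n := (a + b + c)%N.
Notation T := (Omega a b c).
Implicit Types (x y z : T) (f : T -> R) (i j : 'I_n).

Let W x : R := weight s (val x).
Let sgt0 p : 0 < s p := s_gt0 sA_gt0 sAB sBC p.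

Let W_gt0 x : 0 < W x.
Proof. exact: weight_gt0. Qed.

Definition swapO i j x : T :=
  exist _ (swap i j (val x)) (eq_ind_r is_true (valP x) (swap_content a b c i j (val x))).

Definition stepO x : T :=
  exist _ (sort_step (val x)) (eq_ind_r is_true (valP x) (sort_step_content a b c (val x))).

Lemma val_iter_stepO k x : val (iter k stepO x) = iter k (@sort_step n) (val x).
Proof. by elim: k => //= k ->. Qed.

Lemma swapOK i j : involutive (swapO i j).
Proof. by move=> x; apply: val_inj; exact: swapK. Qed.

Lemma sum_Omega (Q : pred (word n)) (F : word n -> R) :
  \sum_(x : T | Q (val x)) F (val x) = \sum_(w | has_content a b c w && Q w) F w.
Proof.
rewrite (reindex_omap (val : T -> word n) insub) /=; last first.
  by move=> w /andP[cw _]; rewrite insubT.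
by apply: eq_bigl => x; rewrite valK eqxx (valP x) andbT.
Qed.

(** A Dirichlet form without its exchange probabilities; the constant [c0] below accounts for
    them. *)
Definition energy f :=
  \sum_(i < n) \sum_(j < n | j == i.+1 :> nat)
     \sum_x W x * (f x - f (swapO i j x)) ^+ 2.

(** A sorting step is the identity or one of the adjacent exchanges, so each state uses at most one
    term of the energy. *)
Lemma stepO_energy f :
  \sum_x W x * (f x - f (stepO x)) ^+ 2 <= energy f.
Proof.
have -> : energy f = \sum_x W x *
    \sum_(i < n) \sum_(j < n | j == i.+1 :> nat) (f x - f (swapO i j x)) ^+ 2.
  rewrite /energy; under eq_bigr => i _ do rewrite exchange_big.
  rewrite exchange_big; apply: eq_bigr => x _; rewrite mulr_sumr.
  by apply: eq_bigr => i _; rewrite mulr_sumr.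
apply: ler_sum => x _; rewrite ler_pM2l //.
have ge0 i : 0 <= \sum_(j < n | j == i.+1 :> nat) (f x - f (swapO i j x)) ^+ 2.
  by apply: sumr_ge0 => j _; apply: sqr_ge0.
case: (sort_step_swap (val x)) => [E|[i [j [ij E]]]].
  have -> : stepO x = x by apply: val_inj.
  by rewrite subrr expr0n; apply: sumr_ge0.
have -> : stepO x = swapO i j x by apply: val_inj.
rewrite (bigD1 i) //= (bigD1 j) /=; last by apply/eqP.
by rewrite -addrA lerDl addr_ge0 // sumr_ge0 // => *; rewrite sqr_ge0.
Qed.

(* Probability that an update at positions [i], [j = i + 1] exchanges the two
   letters; for equal letters the exchange is the identity. *)
Definition swap_prob i j x : R :=
  s (val x i) / (s (val x i) + s (val x j)).

(** For [j = i + 1] this is the conditional expectation of [f] given the state up to the exchange of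
    [i] and [j]. *)
Definition update i j f x : R :=
  (1 - swap_prob i j x) * f x + swap_prob i j x * f (swapO i j x).

Lemma local_step_sum i j f x : i != j ->
  \sum_y local_step s i j (val x) (val y) * f y = update i j f x.
Proof.
move=> ij; have eqv (z y : T) : (val y == val z) = (y == z) by rewrite (inj_eq val_inj).
have sum1 z : \sum_y (y == z)%:R * f y = f z.
  rewrite (bigD1 z) //= eqxx mul1r big1 ?addr0 // => y /negbTE ->.
  by rewrite mul0r.
have s0 : s (val x i) + s (val x j) != 0 by rewrite gt_eqF // addr_gt0.
rewrite /local_step /update /swap_prob; case: eqP => [E|nE].
  have -> : swapO i j x = x.
    apply: val_inj; apply/ffunP => k /=; rewrite ffunE.
    by case: tpermP => [->|->|].
  under eq_bigr do rewrite eqv.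
  by rewrite sum1; ring.
have pl1 : place (val x) i j (val x j) (val x i) = val (swapO i j x).
  apply/ffunP => k; rewrite !ffunE; case: tpermP => [->|->|/eqP ni /eqP nj].
  - by rewrite eqxx.
  - by rewrite eq_sym (negbTE ij) eqxx.
  - by rewrite (negbTE ni) (negbTE nj).
have pl2 : place (val x) i j (val x i) (val x j) = val x.
  apply/ffunP => k; rewrite !ffunE.
  by case: eqP => [->|_] //; case: eqP => [->|].
rewrite pl1 pl2.
under eq_bigr do rewrite !eqv mulrDl -!mulrA.
rewrite big_split /= -!mulr_sumr !sum1; by field.
Qed.

(** Detailed balance: [W x * swap_prob i j x] is invariant under the exchange. *)
Lemma update_balance i j f : j = i.+1 :> nat ->
  \sum_x W x * swap_prob i j x * f (swapO i j x) = \sum_x W x * swap_prob i j x * f x.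
Proof.
move=> ij; rewrite [RHS](reindex_inj (can_inj (swapOK i j))) /=.
apply: eq_bigr => x _; congr (_ * _).
have := weight_swap s (val x) ij; rewrite /swap_prob /W /= !ffunE tpermL tpermR => E.
by rewrite mulrA -E -mulrA; congr (_ * (_ / _)); rewrite addrC.
Qed.

Lemma update_mean i j f : j = i.+1 :> nat ->
  \sum_x W x * update i j f x = \sum_x W x * f x.
Proof.
move=> ij; rewrite (eq_bigr (fun x => W x * f x - W x * swap_prob i j x * f x
  + W x * swap_prob i j x * f (swapO i j x))); last by move=> x _; rewrite /update; ring.
by rewrite big_split sumrB /= update_balance // subrK.
Qed.

Let c0 : R := (s A / (2 * s C)) ^+ 2.

(** All strengths lie between [s A] and [s C], so an exchange and its refusal both have probability
    at least [s A / (2 * s C)]. *)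
Lemma swap_prob_var i j x : c0 <= swap_prob i j x * (1 - swap_prob i j x).
Proof.
have Ap p : s A <= s p by move: sAB sBC; case: p; lra.
have pC p : s p <= s C by move: sAB sBC; case: p; lra.
have bound p q : s A / (2 * s C) <= s p / (s p + s q).
  have C0 := sgt0 C; have := sgt0 p; have := sgt0 q => q0 p0.
  rewrite ler_pdivrMr ?mulr_gt0 // mulrAC ler_pdivlMr ?addr_gt0 //.
  apply: ler_pM (Ap p) _; [exact: ltW|by rewrite ltW ?addr_gt0|].
  by have := pC p; have := pC q; lra.
have b0 : 0 <= s A / (2 * s C) by rewrite divr_ge0 ?mulr_ge0 ?ltW.
rewrite /c0 expr2 ler_pM // ?bound // /swap_prob.
have -> : 1 - s (val x i) / (s (val x i) + s (val x j)) =
    s (val x j) / (s (val x j) + s (val x i)).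
  by field; rewrite !gt_eqF ?addr_gt0.
exact: bound.
Qed.

(** Pointwise, [((1-p)u + pv)^2 = (1-p)u^2 + pv^2 - p(1-p)(u-v)^2]; by balance the first two terms
    sum to the old square norm. *)
Lemma update_contract i j f : j = i.+1 :> nat ->
  \sum_x W x * update i j f x ^+ 2 <=
  \sum_x W x * f x ^+ 2 - c0 * \sum_x W x * (f x - f (swapO i j x)) ^+ 2.
Proof.
move=> ij; pose p x := swap_prob i j x.
rewrite (eq_bigr (fun x => W x * f x ^+ 2 - W x * p x * f x ^+ 2
  + W x * p x * f (swapO i j x) ^+ 2
  - p x * (1 - p x) * (W x * (f x - f (swapO i j x)) ^+ 2))); last first.
  by move=> x _; rewrite /update -/(p x); ring.
rewrite sumrB big_split sumrB /=.
rewrite (update_balance (fun x => f x ^+ 2) ij) subrK lerD2l lerN2 mulr_sumr.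
apply: ler_sum => x _; rewrite ler_wpM2r ?swap_prob_var //.
by rewrite mulr_ge0 ?sqr_ge0 ?ltW.
Qed.

Definition applyX3 f x : R := \sum_y X3 s x y * f y.

Lemma card_adjacent : (1 < n)%N ->
  #|[pred p : 'I_n * 'I_n | p.2 == p.1.+1 :> nat]| = n.-1.
Proof.
case: n => // m _ /=.
pose h (k : 'I_m) := (widen_ord (leqnSn m) k, lift ord0 k).
have hinj : injective h by move=> k l /(congr1 (fun p => val p.1)) /= E; apply: val_inj.
rewrite -[RHS]card_ord -(card_imset predT hinj); apply: eq_card => -[i j].
rewrite !inE /=; apply/eqP/imsetP => [ij|[k _ [-> ->]]] //.
have im : (i < m)%N by rewrite -ltnS -ij.
by exists (Ordinal im) => //; congr pair; apply: val_inj.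
Qed.

Lemma applyX3E f x : (1 < n)%N -> applyX3 f x =
  (n.-1)%:R^-1 * \sum_(i < n) \sum_(j < n | j == i.+1 :> nat) update i j f x.
Proof.
move=> n1; rewrite /applyX3 /X3 leqNgt n1 /=.
under eq_bigr => y _ do rewrite -mulrA mulr_suml.
rewrite -mulr_sumr exchange_big /=; congr (_ * _); apply: eq_bigr => i _.
under eq_bigr => y _ do rewrite mulr_suml.
rewrite exchange_big /=; apply: eq_bigr => j /eqP ij.
by rewrite local_step_sum // -val_eqE /= ij ltn_eqF.
Qed.

Lemma applyX3_mean f : (1 < n)%N ->
  \sum_x W x * applyX3 f x = \sum_x W x * f x.
Proof.
move=> n1; have N0 : ((n.-1)%:R : R) != 0 by rewrite pnatr_eq0; lia.
under eq_bigr => x _ do rewrite applyX3E // pair_big_dep mulrCA mulr_sumr.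
rewrite -mulr_sumr exchange_big /=.
rewrite (eq_bigr (fun=> \sum_x W x * f x)); last first.
  by move=> p /eqP ij; rewrite update_mean.
rewrite (sumr_const [pred p : 'I_n * 'I_n | _]) card_adjacent //.
by rewrite -[(\sum_x _) *+ _]mulr_natl mulKf.
Qed.

Lemma applyX3_contract f : (1 < n)%N ->
  \sum_x W x * applyX3 f x ^+ 2 <=
  \sum_x W x * f x ^+ 2 - c0 / (n.-1)%:R * energy f.
Proof.
move=> n1; have N0 : (0 : R) < (n.-1)%:R by rewrite ltr0n; lia.
set N : R := (n.-1)%:R in N0 *.
pose P := [pred p : 'I_n * 'I_n | p.2 == p.1.+1 :> nat].
(* Convexity: the square of the average over the [n - 1] pairs is at most the average of the
   squares. *)
apply: (@le_trans _ _ (N^-1 * \sum_(p | P p) \sum_x W x * update p.1 p.2 f x ^+ 2)).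
  rewrite exchange_big mulr_sumr; apply: ler_sum => x _.
  rewrite -mulr_sumr [leRHS]mulrCA ler_pM2l // applyX3E // pair_big_dep -/N.
  have := sqr_sum_le P (fun p => update p.1 p.2 f x).
  rewrite card_adjacent // -/N exprMn => le.
  rewrite -[X in _ <= _ * X](mulKf (lt0r_neq0 N0)) [leRHS]mulrA -[X in _ <= X * _]expr2.
  by rewrite ler_pM2l ?exprn_gt0 ?invr_gt0.
rewrite -(ler_pM2l N0) mulrA mulfV ?gt_eqF // mul1r.
apply: (@le_trans _ _ (\sum_(p | P p) (\sum_x W x * f x ^+ 2
   - c0 * \sum_x W x * (f x - f (swapO p.1 p.2 x)) ^+ 2))).
  by apply: ler_sum => p /eqP ij; apply: update_contract.
rewrite sumrB (sumr_const P) card_adjacent // -mulr_sumr.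
have -> : \sum_(p | P p) \sum_x W x * (f x - f (swapO p.1 p.2 x)) ^+ 2 = energy f.
  by rewrite /energy [RHS]pair_big_dep.
rewrite -[(\sum_x _) *+ _]mulr_natl -/N le_eqVlt; apply/orP; left; apply/eqP.
by field; rewrite gt_eqF.
Qed.

(** * The Poincare inequality *)

Hypotheses (ratioAB : s A / s B < 1 / 2) (ratioBC : s B / s C < 1 / 2).

Let Phi : R := (1 - 2 * (s B / s C))^-1.

Let ratio_gt0 : 0 < s B / s C.
Proof. by rewrite divr_gt0. Qed.

Let Phi_gt0 : 0 < Phi.
Proof. by rewrite invr_gt0; move: ratioBC ratio_gt0; lra. Qed.

(** Induction on [k], grouping the preimages by their last state before [x]. Fixed points are
    excluded because mass accumulates there. *)
Lemma pushforward_le k x : stepO x != x ->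
  \sum_(y | iter k stepO y == x) W y <= phase_weight s (val x) * W x.
Proof.
elim: k x => [|k IH] x nx.
  by rewrite (big_pred1 x) // ler_peMl ?phase_weight_ge1 // ltW.
rewrite (partition_big (iter k stepO) (fun z => stepO z == x)) //=.
apply: (@le_trans _ _ (\sum_(z | stepO z == x) phase_weight s (val z) * W z)).
  apply: ler_sum => z zx; apply: le_trans (IH z _).
    rewrite le_eqVlt; apply/orP; left; apply/eqP; apply: eq_bigl => y.
    case: (iter k stepO y =P z) => [->|_]; last by rewrite andbF.
    by rewrite zx.
  (* If [z] were fixed, then [x = z] would be fixed too. *)
  by apply: contraNneq nx => zz; rewrite -(eqP zx) !zz.
rewrite (eq_bigl (fun z => (sort_step (val z) == val x) && (val z != val x))); last first.
  move=> z; rewrite -[_ == x](inj_eq val_inj) /=.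
  case: eqP => //= E; apply/esym; apply: contraNneq nx => zx.
  by apply/eqP; apply: val_inj; rewrite /= -[in LHS]zx E.
rewrite (sum_Omega (fun w => (sort_step w == val x) && (w != val x))
                   (fun w => phase_weight s w * weight s w)).
under eq_bigl => w do rewrite andbA.
exact: sum_children.
Qed.

Lemma poincare f x0 : \sum_x W x * f x = 0 ->
  \sum_x W x * f x ^+ 2 <= (2 * n ^ 2)%:R ^+ 2 * Phi * energy f.
Proof.
move=> mean0; set L := (2 * n ^ 2)%N.
(* [L] bounds the rank, so [L] steps sort every state, and the sorted state is unique. *)
pose g := iter L stepO x0.
have Lg x : iter L stepO x = g.
  apply: val_inj; apply: (@sorted_unique _ a b c).
  - exact: (valP (iter L stepO x)).
  - exact: (valP g).
  - by rewrite val_iter_stepO iter_sort_step_sorted // rank_le.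
  - by rewrite val_iter_stepO iter_sort_step_sorted // rank_le.
pose d z := f z - f (stepO z).
have tele x : f x - f g = \sum_(k < L) d (iter k stepO x).
  rewrite -(Lg x); elim: (L) => [|k IH]; first by rewrite big_ord0 subrr.
  by rewrite big_ord_recr /= -IH /d; ring.
(* Since [f] has mean zero, subtracting the constant [f g] can only increase the square norm. *)
apply: (@le_trans _ _ (\sum_x W x * (f x - f g) ^+ 2)).
  rewrite -subr_ge0 -sumrB.
  rewrite (eq_bigr (fun x => W x * f g ^+ 2 - 2 * f g * (W x * f x))); last first.
    by move=> x _; ring.
  rewrite sumrB -mulr_sumr mean0 mulr0 subr0 sumr_ge0 // => x _.
  by rewrite mulr_ge0 ?sqr_ge0 // ltW.
apply: (@le_trans _ _ (\sum_x W x * (L%:R * \sum_(k < L) d (iter k stepO x) ^+ 2))).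
  apply: ler_sum => x _; rewrite ler_pM2l // tele.
  by have := sqr_sum_le predT (fun k : 'I_L => d (iter k stepO x)); rewrite card_ord.
have -> : \sum_x W x * (L%:R * \sum_(k < L) d (iter k stepO x) ^+ 2) =
    L%:R * \sum_(k < L) \sum_x W x * d (iter k stepO x) ^+ 2.
  rewrite exchange_big mulr_sumr; apply: eq_bigr => x _.
  by rewrite mulrCA mulr_sumr.
rewrite expr2 -!mulrA ler_wpM2l ?ler0n //.
apply: (@le_trans _ _ (\sum_(k < L) Phi * energy f)); last first.
  by rewrite sumr_const card_ord mulr_natl.
apply: ler_sum => k _.
(* The [k]-th increment depends only on the [k]-th iterate [z]; the mass reaching [z] is controlled
   unless [z] is fixed, and then [d z = 0]. *)
rewrite (partition_big (iter k stepO) predT) //=.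
apply: (@le_trans _ _ (\sum_z Phi * (W z * d z ^+ 2))); last first.
  by rewrite -mulr_sumr ler_pM2l // stepO_energy.
apply: ler_sum => z _.
rewrite (eq_bigr (fun x => W x * d z ^+ 2)); last by move=> x /eqP ->.
rewrite -mulr_suml mulrA.
have [zz|nz] := eqVneq (stepO z) z; first by rewrite /d zz subrr expr0n !mulr0.
rewrite ler_wpM2r ?sqr_ge0 //; apply: le_trans (pushforward_le _ nz) _.
by rewrite ler_pM2r // phase_weight_le.
Qed.

End Chain.

(** * From contraction to total variation *)

Section Mixing.
Variables (R : realType) (s : particle -> R).
Hypotheses (sA_gt0 : 0 < s A) (sAB : s A < s B) (sBC : s B < s C).
Hypotheses (ratioAB : s A / s B < 1 / 2) (ratioBC : s B / s C < 1 / 2).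
Variables a b c : nat.
Notation n := (a + b + c)%N.
Notation T := (Omega a b c).
Implicit Types (x y z : T) (t : nat).

Let W x : R := weight s (val x).
Let Z : R := \sum_x W x.
Let W_gt0 x : 0 < W x. Proof. exact: weight_gt0. Qed.

Let Z_gt0 x : 0 < Z.
Proof.
rewrite /Z (bigD1 x) //= ltr_wpDr // sumr_ge0 // => y _; exact: ltW.
Qed.

(** The target [y] comes first: as a function of the start [x], the deviation evolves by
    [applyX3]. *)
Definition deviation t y x : R := kernel_pow (@X3 R s a b c) t x y - stationary s y.

Lemma applyX3_cst (k : R) x : (1 < n)%N -> applyX3 s (fun=> k) x = k.
Proof.
move=> n1; rewrite applyX3E // pair_big_dep /= (eq_bigr (fun=> k)); last first.
  by move=> p _; rewrite /update; ring.
rewrite (sumr_const [pred p : 'I_n * 'I_n | _]) card_adjacent // -[k *+ _]mulr_natl mulKf //.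
by rewrite pnatr_eq0; lia.
Qed.

Lemma deviationS t y x : (1 < n)%N ->
  deviation t.+1 y x = applyX3 s (deviation t y) x.
Proof.
move=> n1; rewrite /deviation /= -[in LHS](applyX3_cst (stationary s y) x n1).
by rewrite /applyX3 -sumrB; apply: eq_bigr => z _; rewrite mulrBr.
Qed.

Lemma deviation_mean t y : (1 < n)%N -> \sum_x W x * deviation t y x = 0.
Proof.
move=> n1; elim: t => [|t IH].
  rewrite /deviation /=.
  rewrite (eq_bigr (fun x => W x * (x == y)%:R - W x * stationary s y)); last first.
    by move=> x _; rewrite mulrBr.
  rewrite sumrB -mulr_suml (bigD1 y) //= eqxx mulr1 big1 ?addr0; last first.
    by move=> x /negbTE ->; rewrite mulr0.
  by rewrite /stationary mulrCA mulfV ?mulr1 ?subrr // gt_eqF // (Z_gt0 y).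
rewrite -[RHS]IH -(applyX3_mean sA_gt0 sAB sBC (deviation t y) n1).
by apply: eq_bigr => x _; rewrite deviationS.
Qed.

Lemma deviation0_le y : \sum_x W x * deviation 0 y x ^+ 2 <= Z.
Proof.
apply: ler_sum => x _; apply: ler_piMr; first exact: ltW.
have p1 : stationary s y <= 1.
  rewrite /stationary ler_pdivrMr ?(Z_gt0 y) // mul1r (bigD1 y) //= lerDl.
  by apply: sumr_ge0 => z _; rewrite ltW // (W_gt0 z).
have p0 : 0 <= stationary s y by rewrite divr_ge0 ?ltW ?(Z_gt0 y) ?(W_gt0 y).
by rewrite /deviation /=; case: (x == y) => /=; nra.
Qed.

(** The numerical hypothesis says that the Poincare constant divided by the contraction constant is
    at most [M], so each step gains a factor [1 - 1/M]. *)
Lemma deviation_contract (M t : nat) y : (1 < n)%N -> (0 < M)%N ->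
  (2 * n ^ 2)%:R ^+ 2 * (1 - 2 * (s B / s C))^-1 <=
     (s A / (2 * s C)) ^+ 2 / (n.-1)%:R * M%:R ->
  \sum_x W x * deviation t y x ^+ 2 <= (1 - M%:R^-1) ^+ t * Z.
Proof.
move=> n1 M0 Mbig; elim: t => [|t IH].
  by rewrite expr0 mul1r deviation0_le.
have M0' : (0 : R) < M%:R by rewrite ltr0n.
have r0 : 0 <= (1 - M%:R^-1 : R) by rewrite subr_ge0 invf_le1 // ler1n.
rewrite exprS -mulrA; apply: le_trans (_ : _ <= (1 - M%:R^-1) *
  \sum_x W x * deviation t y x ^+ 2) _; last by rewrite ler_wpM2l.
rewrite (eq_bigr (fun x => W x * applyX3 s (deviation t y) x ^+ 2)); last first.
  by move=> x _; rewrite deviationS.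
apply: le_trans (applyX3_contract sA_gt0 sAB sBC _ n1) _.
rewrite mulrBl mul1r lerD2l lerN2 ler_pdivrMl //.
apply: le_trans (poincare sA_gt0 sAB sBC ratioAB ratioBC y (deviation_mean t y n1)) _.
rewrite [leRHS]mulrA [M%:R * _]mulrC ler_wpM2r //.
by do 3! [apply: sumr_ge0 => ? _]; rewrite mulr_ge0 ?sqr_ge0 // ltW // weight_gt0.
Qed.

(** Each of the [n] positions costs a factor at most [(2 ^+ l) ^+ n]. Powers of 2 are used here to
    be offset by halvings. *)
Lemma weight_ratio (l : nat) x y : s C <= 2 ^+ l * s A ->
  W y <= 2 ^+ (l * n ^ 2) * W x.
Proof.
move=> lC; rewrite /W /weight.
have -> : 2 ^+ (l * n ^ 2) = \prod_(i < n) (2 ^+ l) ^+ n :> R.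
  by rewrite prodr_const card_ord -!exprM; congr (_ ^+ _); lia.
rewrite -big_split /=; apply: ler_prod => i _.
have sgt0 p := s_gt0 sA_gt0 sAB sBC p.
apply/andP; split; first by rewrite exprn_ge0 // ltW.
apply: (@le_trans _ _ ((2 ^+ l * s (val x i)) ^+ i.+1)).
  apply: lerXn2r; rewrite ?nnegrE; [exact: ltW|by rewrite ltW ?mulr_gt0 ?exprn_gt0|].
  apply: (@le_trans _ _ (2 ^+ l * s A)).
    by apply: le_trans lC; move: sAB sBC; case: (val y i); lra.
  by rewrite ler_pM2l ?exprn_gt0 //; move: sAB sBC; case: (val x i); lra.
rewrite exprMn; apply: ler_wpM2r; first by rewrite exprn_ge0 // ltW.
by rewrite ler_weXn2l // exprn_ege1 // ler1n.
Qed.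

Lemma card_Omega_le : (#|{: T}| <= 4 ^ n)%N.
Proof.
apply: leq_trans (leq_card (val : T -> word n) val_inj) _.
rewrite card_ffun card_ord; case: n => // m; rewrite leq_exp2r //.
apply: leq_trans (leq_card _ (can_inj ord_of_particleK)) _.
by rewrite card_ord.
Qed.

Lemma worst_tv_le (M l : nat) : (1 < n)%N -> (0 < M)%N ->
  (2 * n ^ 2)%:R ^+ 2 * (1 - 2 * (s B / s C))^-1 <=
     (s A / (2 * s C)) ^+ 2 / (n.-1)%:R * M%:R ->
  s C <= 2 ^+ l * s A ->
  worst_tv (@X3 R s a b c) (@stationary R s a b c) (M * (l * n ^ 2 + 6 * n + 2)) <= 1 / 4.
Proof.
(* Of the [m] halvings, [l * n ^ 2 + 2 * n] absorb [Z / W x], and the other [4 * n + 2] yield the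
   square of [1 / (2q)], where [q = 4 ^ n] bounds the number of states. *)
move=> n1 M0 Mbig lC; set m := (l * n ^ 2 + 6 * n + 2)%N.
pose q : R := 2 ^+ (2 * n).
have q0 : 0 < q by rewrite exprn_gt0.
have cardq : #|{: T}|%:R <= q.
  by rewrite /q exprM -natrX -natrX ler_nat card_Omega_le.
have dev x y : `|deviation (M * m) y x| <= (2 * q)^-1.
  have := deviation_contract (M * m) y n1 M0 Mbig.
  (* Only the term of the starting state [x] is kept from the square norm. *)
  rewrite exprM (bigD1 x) //= => le1.
  have {}le1 : W x * deviation (M * m) y x ^+ 2 <= 2^-1 ^+ m * Z.
    apply: le_trans (_ : _ <= ((1 - M%:R^-1) ^+ M) ^+ m * Z) _.
      apply: le_trans le1; rewrite lerDl sumr_ge0 // => z _.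
      by rewrite mulr_ge0 ?sqr_ge0 ?ltW.
    rewrite ler_pM2r ?(Z_gt0 x) // lerXn2r ?nnegrE ?expr_1subV_le_half ?invr_ge0 //.
    by rewrite exprn_ge0 // subr_ge0 invf_le1 ?ler1n ?ltr0n.
  have ZW : Z <= q * 2 ^+ (l * n ^ 2) * W x.
    apply: (@le_trans _ _ (\sum_(y : T) 2 ^+ (l * n ^ 2) * W x)).
      by apply: ler_sum => z _; apply: weight_ratio.
    rewrite sumr_const -[leLHS]mulr_natl [leLHS]mulrA ler_pM2r //.
    by rewrite ler_pM2r ?exprn_gt0.
  have hm : (2^-1 : R) ^+ m * (q * 2 ^+ (l * n ^ 2)) = ((2 * q)^-1) ^+ 2.
    have u0 k : (2 : R) ^+ k != 0 by rewrite expf_neq0 ?pnatr_eq0.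
    have -> : q = (2 ^+ n) ^+ 2 by rewrite -exprM mulnC.
    rewrite /m (exprD _ (l * n ^ 2 + 6 * n)) (exprD _ (l * n ^ 2)).
    rewrite [(6 * n)%N]mulnC (exprM _ n 6) !exprVn; move: (u0 n) (u0 (l * n ^ 2)%N).
    by move: (2 ^+ n) (2 ^+ (l * n ^ 2)) => Q U Q0 U0; field; rewrite Q0 U0.
  have {le1 ZW} : W x * deviation (M * m) y x ^+ 2 <= W x * ((2 * q)^-1) ^+ 2.
    apply: le_trans le1 _; rewrite -hm [leRHS]mulrCA [W x * _]mulrC.
    by rewrite ler_pM2l // exprn_gt0 // invr_gt0.
  rewrite ler_pM2l // -[deviation _ _ _ ^+ 2]real_normK ?num_real //.
  by rewrite ler_sqr ?nnegrE // invr_ge0 mulr_ge0 // ltW.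
rewrite /worst_tv; elim/big_ind: _ => [|u v hu hv|x _].
- by rewrite divr_ge0.
- by rewrite ge_max hu hv.
rewrite /tv_dist.
apply: (@le_trans _ _ (2^-1 * \sum_(y : T) (2 * q)^-1)).
  by rewrite ler_pM2l ?invr_gt0 //; apply: ler_sum => y _; apply: dev.
rewrite sumr_const -[_ *+ #|_|]mulr_natl.
apply: (@le_trans _ _ (2^-1 * (q * (2 * q)^-1))).
  by rewrite ler_pM2l ?invr_gt0 // ler_pM2r // invr_gt0 mulr_gt0.
by rewrite le_eqVlt; apply/orP; left; apply/eqP; field; rewrite gt_eqF.
Qed.

(** Words of length at most 1 are all sorted, so there is a single state. *)
Lemma worst_tv_trivial : (n <= 1)%N ->
  worst_tv (@X3 R s a b c) (@stationary R s a b c) 0 <= 1 / 4.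
Proof.
move=> n1.
have sw (w : word n) : sorted_word w.
  rewrite /sorted_word; apply/andP; split; apply/negP => hd;
    by have [//|k1 _ _] := first_descentP _ hd; lia.
have eqT x y : x = y.
  by apply: val_inj; apply: sorted_unique (valP x) (valP y) _ _.
rewrite /worst_tv; elim/big_ind: _ => [|u v hu hv|x _].
- by rewrite divr_ge0.
- by rewrite ge_max hu hv.
rewrite /tv_dist big1 ?mulr0 ?divr_ge0 // => y _.
rewrite /= (eqT x y) eqxx /stationary (bigD1 y) //= big1 ?addr0.
  by rewrite mulfV ?subrr ?normr0 // gt_eqF // (W_gt0 y).
by move=> z; rewrite (eqT z y) eqxx.
Qed.

End Mixing.

Theorem theorem2 (R : realType) (s : particle -> R)
    (sA_gt0 : 0 < s A) (sAB : s A < s B) (sBC : s B < s C)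
    (ratioAB : s A / s B < 1 / 2) (ratioBC : s B / s C < 1 / 2) :
  exists K : R, forall a b c : nat,
    exists t : nat,
      is_mixing_time (@X3 R s a b c) (@stationary R s a b c) t /\
      t%:R <= K * (a + b + c)%:R ^+ 10.
Proof.
have sgt0 p := s_gt0 sA_gt0 sAB sBC p.
pose Phi : R := (1 - 2 * (s B / s C))^-1.
pose c0 : R := (s A / (2 * s C)) ^+ 2.
have c00 : 0 < c0 by rewrite exprn_gt0 // divr_gt0 // mulr_gt0.
have Phi0 : 0 < Phi by rewrite invr_gt0; move: ratioBC; lra.
have bnd (u : R) : 0 <= u -> exists k : nat, (0 < k)%N /\ u <= k%:R.
  move=> u0; exists (Num.truncn u).+1; split=> //.
  by apply: ltW; have /andP[] := truncn_itv u0.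
(* The 4 comes from squaring the path length [2 * n ^ 2]; the remaining [n ^ 4] and the [n - 1] of
   the averaging give [M = D * n ^ 5]. *)
have [|D [D0 hD]] := bnd (4 * Phi / c0); first by rewrite ltW // divr_gt0 // mulr_gt0.
have [|l [_ hl]] := bnd (s C / s A); first by rewrite ltW // divr_gt0.
exists (D * (l + 8))%:R => a b c; set n := (a + b + c)%N.
have [t0 [tv0 t0le]] : exists t0 : nat,
    worst_tv (@X3 R s a b c) (@stationary R s a b c) t0 <= 1 / 4 /\
    (t0 <= D * (l + 8) * n ^ 10)%N.
  have [n1|n1] := leqP n 1.
    (* Time 0 meets the bound even when [n = 0], where the right-hand side vanishes. *)
    by exists 0%N; split=> //; apply: worst_tv_trivial.
  have n0 : (0 < n)%N by apply: ltnW.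
  exists (D * n ^ 5 * (l * n ^ 2 + 6 * n + 2))%N; split.
    apply: worst_tv_le => //.
    - by rewrite muln_gt0 D0 expn_gt0 n0.
    - rewrite -/Phi -/c0 -/n.
      have N0 : (0 : R) < n.-1%:R by rewrite ltr0n; lia.
      rewrite [leRHS]mulrAC ler_pdivlMr //.
      rewrite ler_pdivrMr // in hD.
      have nn : (n.-1)%:R <= n%:R :> R by rewrite ler_nat leq_pred.
      rewrite (natrM _ 2) (natrM _ D) !natrX.
      apply: (@le_trans _ _ (n%:R ^+ 4 * (4 * Phi) * n%:R)).
        rewrite [leLHS](_ : _ = n%:R ^+ 4 * (4 * Phi) * n.-1%:R); last by ring.
        by rewrite ler_wpM2l // !mulr_ge0 ?exprn_ge0 // ltW.
      rewrite [leRHS](_ : _ = n%:R ^+ 4 * (D%:R * c0) * n%:R); last by ring.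
      by rewrite ler_wpM2r // ler_wpM2l // exprn_ge0.
    - rewrite -ler_pdivrMr //; apply: le_trans hl _.
      by rewrite -natrX ler_nat ltnW // ltn_expl.
  have n2 : (l * n ^ 2 + 6 * n + 2 <= (l + 8) * n ^ 2)%N by nia.
  (* The argument gives exponent 7, which is relaxed to 10. *)
  have n7 : (n ^ 7 <= n ^ 10)%N by rewrite leq_exp2l.
  apply: (@leq_trans (D * n ^ 5 * ((l + 8) * n ^ 2))).
    by rewrite leq_mul2l n2 orbT.
  rewrite (_ : _ * _ = D * (l + 8) * n ^ 7)%N; last by ring.
  by rewrite leq_mul2l n7 orbT.
have ex : exists t, worst_tv (@X3 R s a b c) (@stationary R s a b c) t <= 1 / 4.
  by exists t0.
(* The mixing time is the least admissible time, hence at most [t0]. *)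
case: (ex_minnP ex) => t tvt tmin; exists t; split; first by split.
rewrite -natrX -natrM ler_nat; apply: leq_trans t0le; exact: tmin.
Qed.
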